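(* Let $n\ge1$ and $\tau\in S_n$ with schedule $(w_1,\dots,w_n)$, and suppose the runs of $\tau$, from left to right, have lengths $\rho_r,\dots,\rho_1,\rho_0$. If $1\le l\le r$, then the multiset of $l$-schedule numbers $\{w^{(l)}(c):1\le c\le n\}$ equals the multiset $\{w_i:1\le i\le n\}\cup\{\rho_l\}\setminus\{\rho_0\}$. Hence $$\sum_{\substack{Pr\in \mathcal{P}ref_n\\ \operatorname{diagword}(Pr)=\tau\\ l(Pr)=l}} t^{\operatorname{area}(Pr)}q^{\operatorname{dinv}(Pr)} = t^{\operatorname{maj}(\tau)}\, q^{\rho_0+\dots+\rho_{l-1}}\,\frac{[\rho_l]_q}{[\rho_0]_q}\prod_{i=1}^n[w_i]_q.$$
   Context: Runs of a permutation are its maximal increasing contiguous segments. Schedule of $\tau\in S_n$: if the last run of $\tau$ has length $k$, set $w_i=i$ for $1\le i\le k$; for $k<i\le n$, $w_i$ is the number of elements of the run containing $\tau_{n+1-i}$ that are larger than $\tau_{n+1-i}$ plus the number of elements smaller than $\tau_{n+1-i}$ in the next run. $l$-schedule numbers: let $l\ge0$ and let $\tau$ have at least $l+1$ runs. For $1\le c\le n$: if $c$ lies in one of the last $l$ runs, $w^{(l)}(c)$ is the number of elements smaller than $c$ in its own run plus the number of elements larger than $c$ in the previous run; if $c$ lies in the $(l+1)$-st run from the end, $w^{(l)}(c)$ is the number of elements of that run weakly to the right of $c$ (counting $c$); otherwise $w^{(l)}(c)$ is the number of elements larger than $c$ in its own run plus the number of elements smaller than $c$ in the next run. A preference function on $n$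 cars is a map $f:[n]\to[n]$; $\mathcal{P}ref_n$ is the set of them. It is drawn as a labeled lattice path in the $n\times n$ grid: for $j=1,\dots,n$ in turn, the cars in $f^{-1}(j)$ are written in column $j$ in increasing order bottom to top in the lowest unused rows. A car in the cell with lower-left corner $(x,y)$ lies in diagonal $y-x$. The deviation $l(Pr)$ is the maximum over cars of minus their diagonal (always $\ge0$). $\operatorname{area}(Pr)=\sum_c(d(c)+l(Pr))$, $d(c)$ the diagonal of car $c$. $\operatorname{dinv}(Pr)$ = (number of pairs of cars in the same diagonal with the left one smaller) + (number of pairs $b<a$ with $a$ in diagonal $m+1$, $b$ in diagonal $m$, and $b$ in a column strictly right of $a$) + (number of cars in negative diagonals). $\operatorname{diagword}(Pr)$ lists the cars of each nonempty diagonal in increasing order, diagonals from highest to lowest. $\operatorname{maj}(\tau)$ is the sum of descent positions of $\tau$; $[m]_q=1+q+\dots+q^{m-1}$. *)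

(* Defs.v *)
From HB Require Import structures.
From mathcomp Require Import all_boot all_order all_algebra.
Set Implicit Arguments. Unset Strict Implicit. Unset Printing Implicit Defensive.
Import Order.TTheory GRing.Theory Num.Theory.

(* Permutations tau of [n] are sequences of nats with perm_eq tau (iota 1 n). *)

Fixpoint runs (s : seq nat) : seq (seq nat) :=
  match s with
  | [::] => [::]
  | x :: s' =>
    match runs s' with
    | (y :: r) :: rs =>
        if x < y then (x :: y :: r) :: rs else [:: x] :: (y :: r) :: rs
    | _ => [:: [:: x]]
    end
  end.

Definition nruns (tau : seq nat) : nat := size (runs tau).
Definition rho (tau : seq nat) (j : nat) : nat := size (nth [::] (rev (runs tau)) j).

Definition run_index (tau : seq nat) (c : nat) : nat := find (fun R => c \in R) (runs tau).
Definition run_of (tau : seq nat) (c : nat) : seq nat := nth [::] (runs tau) (run_index tau c).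
Definition next_run (tau : seq nat) (c : nat) : seq nat :=
  nth [::] (runs tau) (run_index tau c).+1.
Definition prev_run (tau : seq nat) (c : nat) : seq nat :=
  nth [::] (runs tau) (run_index tau c).-1.
Definition run_index_from_end (tau : seq nat) (c : nat) : nat :=
  (nruns tau).-1 - run_index tau c.

Definition sched_num (tau : seq nat) (c : nat) : nat :=
  count (fun y => c < y) (run_of tau c) + count (fun y => y < c) (next_run tau c).

Definition schedule (tau : seq nat) : seq nat :=
  let n := size tau in
  let k := size (last [::] (runs tau)) in
  [seq (if i <= k then i else sched_num tau (nth 0 tau (n - i))) | i <- iota 1 n].

Definition lsched (tau : seq nat) (l : nat) (c : nat) : nat :=
  let e := run_index_from_end tau c in
  if e < l then
    count (fun y => y < c) (run_of tau c) + count (fun y => c < y) (prev_run tau c)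
  else if e == l then
    size (drop (index c (run_of tau c)) (run_of tau c))
  else sched_num tau c.

Definition maj (tau : seq nat) : nat :=
  \sum_(1 <= i < size tau | nth 0 tau i < nth 0 tau i.-1) i.

Definition qint (R : nzSemiRingType) (q : R) (m : nat) : R := (\sum_(i < m) q ^+ i)%R.

(* Preference functions on n cars: car (val i).+1 prefers column (val (f i)).+1. *)
Section Pref.
Variable n : nat.
Implicit Types f : {ffun 'I_n -> 'I_n}.

(* 0-based x-coordinate (column - 1) of the lower-left corner of car c's cell *)
Definition pcol f (c : 'I_n) : nat := f c.
(* 0-based y-coordinate (row - 1): cars are placed column by column, in
   increasing order bottom to top, in the lowest unused rows *)
Definition prow f (c : 'I_n) : nat :=
  #|[set d : 'I_n | (f d < f c)%N || ((f d == f c) && (d < c)%N)]|.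

Definition pdiag f (c : 'I_n) : int := ((prow f c)%:Z - (pcol f c)%:Z)%R.

(* deviation: max over cars of -(diagonal); the truncated subtraction
   x - y equals max(0, -diag), and the maximum is >= 0 anyway *)
Definition pdev f : nat := \max_(c : 'I_n) (pcol f c - prow f c).

Definition parea f : int := (\sum_(c : 'I_n) (pdiag f c + (pdev f)%:Z))%R.

Definition pdinv f : nat :=
  #|[set p : 'I_n * 'I_n | (pdiag f p.1 == pdiag f p.2) &&
        (pcol f p.1 < pcol f p.2)%N && (p.1 < p.2)%N]|
  + #|[set p : 'I_n * 'I_n | let a := p.1 in let b := p.2 in
        (b < a)%N && (pdiag f a == pdiag f b + 1)%R && (pcol f a < pcol f b)%N]|
  + #|[set c : 'I_n | (pdiag f c < 0)%R]|.

Definition diag_range : seq int := [seq ((n%:Z - 1) - i%:Z)%R | i <- iota 0 (2 * n).-1].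

Definition diagword f : seq nat :=
  flatten [seq [seq (val c).+1 | c <- enum 'I_n & pdiag f c == d] | d <- diag_range].
End Pref.

(* Main.v *)
Require Import Defs.
From HB Require Import structures.
From mathcomp Require Import all_boot all_order all_algebra zify.
Set Implicit Arguments. Unset Strict Implicit. Unset Printing Implicit Defensive.
Import Order.TTheory GRing.Theory Num.Theory.

(** Reading the cars of a preference function row by row gives a linear order in which the
    diagonal rises by at most 1 at each step, and rises only from a smaller to a larger car; the
    first car has diagonal at most 0 and the last one at least 0. Conversely such an order, with
    the diagonals of its cars, determines the function. Consequently every diagonal between the
    lowest and the highest one is occupied, with a descent between consecutive ones, so the
    diagonals are the runs of the diagonal word, and prescribing the diagonal word and the
    deviation amounts to prescribing all diagonals.

    For fixed diagonals, the smallest car c of a highest positive diagonal can be deleted, and it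
    can be reinserted exactly after the cars it attacks, i.e. those forming with c a pair counted
    by dinv when placed after c; the successive places add w - 1, ..., 1, 0 to dinv, whence a
    factor [w]_q. The largest car of a lowest negative diagonal is treated symmetrically, and
    diagonal 0 alone gives a q-factorial. *)

Local Notation rie := run_index_from_end.

(** * Sums over insertions *)

(** Deleting [c] recovers [u] and the index of [c] recovers [i], so all insertions differ;
    conversely a permutation of [c :: s] splits at its only [c]. *)
Lemma perm_permutations_cons (T : eqType) (c : T) (s : seq T) :
  c \notin s ->
  perm_eq (permutations (c :: s))
    [seq take i u ++ c :: drop i u | u <- permutations s, i <- iota 0 (size u).+1].
Proof.
move=> cNs; apply: uniq_perm; first exact: permutations_uniq.
  apply: allpairs_uniq_dep => [||p1 p2].
  - exact: permutations_uniq.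
  - by move=> u _; exact: iota_uniq.
  move=> /allpairsPdep[u1 [i1 [u1P i1P ->]]] /allpairsPdep[u2 [i2 [u2P i2P ->]]] /=.
  have H u i : u \in permutations s -> i \in iota 0 (size u).+1 ->
     rem c (take i u ++ c :: drop i u) = u /\ index c (take i u ++ c :: drop i u) = i.
    rewrite mem_permutations mem_iota /= ltnS => us iu.
    have cu : c \notin u by rewrite (perm_mem us).
    have ct : c \notin take i u by apply/negP => /mem_take; rewrite (negPf cu).
    split.
      by rewrite remE index_cat (negPf ct) /= eqxx addn0 take_size_cat // -cat_rcons
        drop_size_cat ?size_rcons // cat_take_drop.
    by rewrite index_cat (negPf ct) /= eqxx addn0 size_takel.
  have [r1 j1] := H _ _ u1P i1P; have [r2 j2] := H _ _ u2P i2P.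
  move=> e; rewrite e in r1 j1; have eu : u1 = u2 by apply: etrans r2.
  by have ei : i1 = i2 by [apply: etrans j2]; rewrite eu ei.
move=> v; rewrite mem_permutations; apply/idP/allpairsPdep.
  move=> pv; have cv : c \in v by rewrite (perm_mem pv) mem_head.
  case/splitPr: cv pv => v1 v2 pv; exists (v1 ++ v2), (size v1); split.
  - rewrite mem_permutations -(perm_cons c); apply: perm_trans pv.
    by rewrite perm_sym perm_catC /= perm_cons perm_catC.
  - by rewrite mem_iota /= size_cat ltnS leq_addr.
  - by rewrite take_size_cat // drop_size_cat.
case=> u [i [+ _ ->]]; rewrite mem_permutations => us.
by rewrite perm_catC /= perm_cons perm_catC cat_take_drop.
Qed.

Lemma perm_permutations_map (T U : eqType) (f : T -> U) (s : seq T) :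
  injective f -> uniq s ->
  perm_eq (permutations (map f s)) (map (map f) (permutations s)).
Proof.
move=> fI su; rewrite perm_sym; apply: uniq_perm; rewrite ?permutations_uniq //.
  by rewrite map_inj_uniq ?permutations_uniq //; exact: inj_map.
apply: (uniq_min_size _ _ _).2.
- by rewrite map_inj_uniq ?permutations_uniq //; exact: inj_map.
- by move=> _ /mapP[u + ->]; rewrite !mem_permutations; exact: perm_map.
- by rewrite size_map !size_permutations ?map_inj_uniq // size_map.
Qed.

Section InsertionSum.
Variables (R : comNzRingType) (q : R).
Local Open Scope ring_scope.

Lemma sum_permutations_cons (T : eqType) (c : T) (s : seq T) (F : seq T -> R) :
  c \notin s ->
  \sum_(u <- permutations (c :: s)) F u =
  \sum_(u <- permutations s) \sum_(i < (size u).+1) F (take i u ++ c :: drop i u).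
Proof.
move=> cs; rewrite (perm_big _ (perm_permutations_cons cs)) big_allpairs_dep.
by apply: eq_bigr => u _; rewrite -(big_mkord xpredT (fun i => F (take i u ++ c :: drop i u))).
Qed.

(** The admissible places are those directly after an entry of [E], with [x0] standing before the
    first entry; from right to left their exponents are 0, 1, 2 and so on. *)
Lemma sum_insert_after (T : Type) (E : pred T) (x0 : T) (u : seq T) :
  \sum_(i < (size u).+1 | E (last x0 (take i u))) q ^+ count E (drop i u) =
  qint q (E x0 + count E u)%N.
Proof.
elim: u x0 => [|y u IH] x0 /=.
  by rewrite big_mkcond big_ord1 /= addn0 /qint; case: (E x0); rewrite ?big_ord0 ?big_ord1.
rewrite big_mkcond big_ord_recl -big_mkcond /= IH.
case: (E x0) => /=; last by rewrite add0r.
by rewrite add1n /qint big_ord_recr /= addrC.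
Qed.

(** Here the exponents grow from left to right: passing the head multiplies the remaining sum by [q]
    exactly when the head satisfies [E]. *)
Lemma sum_insert_before (T : Type) (E : pred T) (x0 : T) (u : seq T) :
  \sum_(i < (size u).+1 | E (head x0 (drop i u))) q ^+ count E (take i u) =
  qint q (E x0 + count E u)%N.
Proof.
elim: u => [|y u IH] /=.
  by rewrite big_mkcond big_ord1 /= addn0 /qint; case: (E x0); rewrite ?big_ord0 ?big_ord1.
rewrite big_mkcond big_ord_recl -big_mkcond /=.
under eq_bigr do rewrite exprD.
rewrite -big_distrr /= IH addnCA /qint.
case: (E y); rewrite /= ?expr0 ?mul1r ?add0r // add1n big_ord_recl mulr_sumr.
by congr (_ + _); apply: eq_bigr => i _; rewrite -exprD.
Qed.

End InsertionSum.

(* a car, given by its label and its diagonal *)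
Definition car := (nat * int)%type.

(** The order of the diagonal word: higher diagonals first, labels increasing within a diagonal. *)
Definition lexdiag (a b : car) : bool :=
  (b.2 < a.2)%R || ((a.2 == b.2) && (a.1 < b.1)).

(** The move allowed between cars in consecutive rows: a rise of the diagonal means that both cars
    share a column, hence that the label increases. *)
Definition step (a b : car) : bool :=
  (b.2 <= a.2)%R || ((b.2 == a.2 + 1)%R && (a.1 < b.1)).

(** The pairs that count in dinv when [a] precedes [b] in the order by rows. *)
Definition attack (a b : car) : bool :=
  ((a.2 == b.2) && (a.1 < b.1)) || ((a.2 == b.2 + 1)%R && (b.1 < a.1)).

(* The sentinels force the first car to have diagonal at most 0 and the last one at least 0, as long
   as the labels lie strictly between 0 and [N]. *)
Definition valid (N : nat) (u : seq car) : bool :=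
  path step (0, (-1)%R) (rcons u (N, 1%R)).

Fixpoint attacks (u : seq car) : nat :=
  if u is a :: u' then count (attack a) u' + attacks u' else 0.

Lemma attacks_insert (c : car) (u v : seq car) :
  attacks (u ++ c :: v) = attacks (u ++ v) + count (attack^~ c) u + count (attack c) v.
Proof. by elim: u => [|a u IH] /=; rewrite ?IH ?count_cat /=; lia. Qed.

(** The predicate is a parameter because diagonal 0 is reduced down to the empty list, which [valid]
    rejects. *)
Definition wsum (R : comNzRingType) (q : R) (V : pred (seq car)) (u : seq car) : R :=
  (\sum_(v <- permutations u | V v) q ^+ attacks v)%R.

(** * Deleting and reinserting an extreme car *)

Section Wsum.
Variables (R : comNzRingType) (q : R).
Local Open Scope ring_scope.

(** No car of [s] attacks [c], so inserting [c] adds just the number of cars of [E] behind it; as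
    [V] allows exactly the places after such cars (or the front, if [E x0]), [sum_insert_after]
    yields the factor. *)
Lemma wsum_insert_after (V : pred (seq car)) (E : pred car) (x0 c : car) (s : seq car) :
  c \notin s ->
  {in s, forall x, attack x c = false} -> {in s, attack c =1 E} ->
  (forall u v, perm_eq (u ++ v) s -> V (u ++ c :: v) = V (u ++ v) && E (last x0 u)) ->
  wsum q V (c :: s) = qint q (E x0 + count E s)%N * wsum q V s.
Proof.
move=> cs xc cx VE; rewrite /wsum big_mkcond sum_permutations_cons // mulr_sumr.
rewrite [RHS]big_mkcond; apply: eq_big_seq => u; rewrite mem_permutations => us.
have ut i : perm_eq (take i u ++ drop i u) s by rewrite cat_take_drop.
under eq_bigr => i _.
  rewrite VE // cat_take_drop attacks_insert cat_take_drop.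
  rewrite (eq_in_count (a2 := pred0)) ?count_pred0 ?addn0; last first.
    by move=> x /mem_take xu; apply: xc; rewrite -(perm_mem us).
  rewrite (eq_in_count (a2 := E)); last first.
    by move=> x /mem_drop xu; apply: cx; rewrite -(perm_mem us).
  rewrite exprD.
  over.
case: (V u) => /=; last by rewrite big1.
rewrite -big_mkcond /= -big_distrr /= sum_insert_after mulrC.
by rewrite (permP us).
Qed.

Lemma wsum_insert_before (V : pred (seq car)) (E : pred car) (x0 c : car) (s : seq car) :
  c \notin s ->
  {in s, forall x, attack c x = false} -> {in s, attack^~ c =1 E} ->
  (forall u v, perm_eq (u ++ v) s -> V (u ++ c :: v) = V (u ++ v) && E (head x0 v)) ->
  wsum q V (c :: s) = qint q (E x0 + count E s)%N * wsum q V s.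
Proof.
move=> cs xc cx VE; rewrite /wsum big_mkcond sum_permutations_cons // mulr_sumr.
rewrite [RHS]big_mkcond; apply: eq_big_seq => u; rewrite mem_permutations => us.
have ut i : perm_eq (take i u ++ drop i u) s by rewrite cat_take_drop.
under eq_bigr => i _.
  rewrite VE // cat_take_drop attacks_insert cat_take_drop.
  rewrite [count (attack c) _](eq_in_count (a2 := pred0)) ?count_pred0 ?addn0; last first.
    by move=> x /mem_drop xu; apply: xc; rewrite -(perm_mem us).
  rewrite (eq_in_count (a2 := E)); last first.
    by move=> x /mem_take xu; apply: cx; rewrite -(perm_mem us).
  rewrite exprD.
  over.
case: (V u) => /=; last by rewrite big1.
rewrite -big_mkcond /= -big_distrr /= sum_insert_before mulrC.
by rewrite (permP us).
Qed.

Lemma wsum_perm (V : pred (seq car)) (s t : seq car) :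
  perm_eq s t -> wsum q V s = wsum q V t.
Proof. by move=> st; rewrite /wsum (perm_big _ (perm_permutations st)). Qed.

Lemma lexdiag_irr : irreflexive lexdiag.
Proof. by case=> a i; rewrite /lexdiag /=; lia. Qed.

Lemma lexdiag_trans : transitive lexdiag.
Proof. by move=> [b j] [a i] [c k]; rewrite /lexdiag /=; lia. Qed.

(** Only the neighbours of [c] matter, with the sentinels serving at the ends: the step from [a] to
    [b] is replaced by two steps through [c]. *)
Lemma valid_insert (N : nat) (c : car) (s u v : seq car) (E : bool) :
  let a := last (0%N, -1) u in let b := head (N, 1) v in
  perm_eq (u ++ v) s ->
  (a \in (0%N, -1) :: s -> b \in (N, 1) :: s ->
    step a c && step c b = step a b && E) ->
  valid N (u ++ c :: v) = valid N (u ++ v) && E.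
Proof.
move=> a b us H; have {}H : step a c && step c b = step a b && E.
  apply: H; last first.
    rewrite inE -(perm_mem us) mem_cat /b; case: (v) => [|y w]; first by rewrite eqxx.
    by rewrite mem_head !orbT.
  rewrite inE -(perm_mem us) mem_cat /a; case/lastP: (u) => [|w y]; first by rewrite eqxx.
  by rewrite last_rcons mem_rcons mem_head !orbT.
rewrite /valid !rcons_cat !cat_path -/a rcons_cons /= -andbA; congr (_ && _).
rewrite /b in H; case: v {b us} H => [|y v] /= H; rewrite andbA H.
  by rewrite !andbT.
by rewrite andbAC.
Qed.

(** No diagonal is higher than that of [c], so leaving [c] is always allowed and [step a c] amounts
    to [attack c a]. Deleting [c] does no harm either: a rise from [a] to another car [b] of the top
    diagonal is legal since [c] has the smallest label there, whence [a.1 < c.1 < b.1]. *)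
Lemma wsum_top (N : nat) (c : car) (s : seq car) :
  pairwise lexdiag (c :: s) -> all (fun x => 0 < x.1 < N)%N (c :: s) -> 0 < c.2 ->
  wsum q (valid N) (c :: s) = qint q (count (attack c) s) * wsum q (valid N) s.
Proof.
move=> pcs; have := pairwise_uniq lexdiag_irr pcs; move: pcs.
rewrite pairwise_cons /= => /andP[/allP cs ps] /andP[cNs us] /andP[cN /allP sN] c0.
have attack_a0 : attack c (0%N, -1) = false by move: c0; rewrite /attack /=; lia.
rewrite (@wsum_insert_after (valid N) (attack c) (0%N, -1)) ?attack_a0 //.
  move=> x /cs; case: c x {c0 cN cs sN attack_a0 cNs} => [c k] [x i].
  by rewrite /lexdiag /attack /=; lia.
move=> u v uv; apply: (valid_insert uv) => au bv.
set a := last _ _ in au *; set b := head _ _ in bv *.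
have {}au : (a == (0%N, -1)) || [&& lexdiag c a, 0 < a.1 & a.1 < N]%N.
  by move: au; rewrite inE => /orP[-> //|aa]; rewrite cs // sN // orbT.
have {}bv : (b == (N, 1)) || lexdiag c b.
  by move: bv; rewrite inE => /orP[-> //|bb]; rewrite cs // orbT.
move: au bv c0 cN; rewrite -!pair_eqE /pair_eq /lexdiag /step /attack /=.
move: a b c {cs cNs attack_a0} => [a i] [b j] [c k] /=.
lia.
Qed.

(** Mirror image of [wsum_top]: entering [c] is always allowed, and [step c b] amounts to
    [attack b c]. *)
Lemma wsum_bottom (N : nat) (c : car) (s : seq car) :
  pairwise lexdiag (rcons s c) -> all (fun x => 0 < x.1 < N)%N (rcons s c) -> c.2 < 0 ->
  wsum q (valid N) (rcons s c) = qint q (count (attack^~ c) s) * wsum q (valid N) s.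
Proof.
move=> pcs; have := pairwise_uniq lexdiag_irr pcs; move: pcs.
rewrite pairwise_rcons rcons_uniq all_rcons.
move=> /andP[/allP cs ps] /andP[cNs us] /andP[cN /allP sN] c0.
have attack_z : attack (N, 1) c = false by move: c0 cN; rewrite /attack /=; lia.
rewrite (wsum_perm _ (permEl (perm_rcons c s))).
rewrite (@wsum_insert_before (valid N) (attack^~ c) (N, 1)) ?attack_z //.
  move=> x /cs; case: c x {c0 cN cs sN attack_z cNs} => [c k] [x i].
  by rewrite /lexdiag /attack /=; lia.
move=> u v uv; apply: (valid_insert uv) => au bv.
set a := last _ _ in au *; set b := head _ _ in bv *.
have {}au : (a == (0%N, -1)) || lexdiag a c.
  by move: au; rewrite inE => /orP[-> //|aa]; rewrite cs // orbT.
have {}bv : (b == (N, 1)) || [&& lexdiag b c, 0 < b.1 & b.1 < N]%N.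
  by move: bv; rewrite inE => /orP[-> //|bb]; rewrite cs // sN // orbT.
move: au bv c0 cN; rewrite -!pair_eqE /pair_eq /lexdiag /step /attack /=.
move: a b c {cs cNs attack_z} => [a i] [b j] [c k] /=.
lia.
Qed.

Lemma valid_diag0 (N : nat) (s : seq car) :
  s != [::] -> all (fun x => (x.2 == 0) && (0 < x.1 < N)%N) s -> valid N s.
Proof.
case: s => // x s _ /= /andP[/andP[/eqP x0 xN] sN].
rewrite /valid /= {1}/step /= x0 (andP xN).1 /=.
elim: s x x0 xN sN => [|y s IH] x x0 xN /=.
  by rewrite /step /= x0 (andP xN).2.
by move=> /andP[/andP[/eqP y0 yN] sN]; rewrite /step x0 y0 /= IH.
Qed.

(** The first car has the smallest label and attacks all the others, so every place is open to it.
    The induction ends at the empty list, hence [predT] in place of [valid]. *)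
Lemma wsum_predT_diag0 (s : seq car) :
  pairwise lexdiag s -> all (fun x => x.2 == 0) s ->
  wsum q predT s = \prod_(c <- s) qint q (count (fun x => c.1 <= x.1)%N s).
Proof.
elim: s => [|c s IH].
  by rewrite /wsum big_nil (_ : permutations [::] = [:: [::]]) // big_seq1 expr0.
move=> pcs; have := pairwise_uniq lexdiag_irr pcs; move: pcs.
rewrite pairwise_cons /= => /andP[/allP cs ps] /andP[cNs us] /andP[/eqP c0 s0].
have lt_c x : x \in s -> (c.1 < x.1)%N.
  by move=> xs; have := cs _ xs; rewrite /lexdiag c0 (eqP (allP s0 _ xs)) ltxx.
rewrite (@wsum_insert_after predT predT c) //; last first.
- move=> x xs; rewrite /attack c0 (eqP (allP s0 _ xs)) lt_c //.
- by move=> x xs; have := lt_c _ xs; rewrite /attack c0 (eqP (allP s0 _ xs)) /=; lia.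
rewrite IH // big_cons /= leqnn count_predT; congr (qint q _ * _).
  by congr (_ + _)%N; rewrite -count_predT; apply: eq_in_count => x /lt_c /ltnW ->.
apply: eq_big_seq => x xs; congr (qint q _).
by rewrite leqNgt lt_c.
Qed.

Lemma wsum_diag0 (N : nat) (s : seq car) : s != [::] ->
  pairwise lexdiag s -> all (fun x => (x.2 == 0) && (0 < x.1 < N)%N) s ->
  wsum q (valid N) s = \prod_(c <- s) qint q (count (fun x => c.1 <= x.1)%N s).
Proof.
move=> s0 ps sN; rewrite -wsum_predT_diag0 //; last first.
  by apply: sub_all sN => x /andP[].
rewrite /wsum big_seq_cond [RHS]big_seq_cond; apply: eq_bigl => u.
rewrite mem_permutations; case: (boolP (perm_eq u s)) => //= us.
apply: valid_diag0; first by rewrite -size_eq0 (perm_size us) size_eq0.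
by rewrite (perm_all _ us).
Qed.

(** An attack goes from an earlier to a later car of the diagonal order, so counting in the whole
    list gives the same number as counting in what remains when [c] is deleted. *)
Lemma wsum_positive_part (N : nat) (p s : seq car) :
  pairwise lexdiag (p ++ s) -> all (fun x => 0 < x.1 < N)%N (p ++ s) ->
  all (fun x => 0 < x.2) p ->
  wsum q (valid N) (p ++ s) =
    \prod_(c <- p) qint q (count (attack c) (p ++ s)) * wsum q (valid N) s.
Proof.
elim: p => [|c p IH]; first by rewrite big_nil mul1r.
rewrite cat_cons => pcs aN /andP[c0 p0]; rewrite (wsum_top pcs aN c0) IH //; first last.
- by case/andP: aN.
- by case/andP: pcs.
rewrite big_cons mulrA; congr (_ * _ * _).
  congr (qint q _); rewrite /= (_ : attack c c = false) //.
  by rewrite /attack !ltnn andbF andbF.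
apply: eq_big_seq => x xp; congr (qint q _) => /=.
have : lexdiag c x.
  by case/andP: pcs => /allP + _; apply; rewrite mem_cat xp.
by case: (c) (x) => [d k] [y i]; rewrite /lexdiag /attack /=; lia.
Qed.

Lemma wsum_negative_part (N : nat) (s m : seq car) :
  pairwise lexdiag (s ++ m) -> all (fun x => 0 < x.1 < N)%N (s ++ m) ->
  all (fun x => x.2 < 0) m ->
  wsum q (valid N) (s ++ m) =
    \prod_(c <- m) qint q (count (attack^~ c) (s ++ m)) * wsum q (valid N) s.
Proof.
elim/last_ind: m => [|m c IH]; first by rewrite big_nil mul1r cats0.
rewrite -rcons_cat => pcs aN; rewrite all_rcons => /andP[c0 m0].
rewrite (wsum_bottom pcs aN c0) IH //; first last.
- by move: aN; rewrite all_rcons => /andP[].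
- by move: pcs; rewrite pairwise_rcons => /andP[].
rewrite -cats1 big_cat big_seq1 /= mulrA mulrC [RHS]mulrC; congr (_ * _).
rewrite mulrC; congr (_ * _); last first.
  by congr (qint q _); rewrite -cats1 [RHS]count_cat /= /attack !ltnn !andbF /= !addn0.
apply: eq_big_seq => x xp; congr (qint q _).
rewrite -cats1 [RHS]count_cat /= !addn0.
have : lexdiag x c.
  by move: pcs; rewrite pairwise_rcons => /andP[/allP + _]; apply; rewrite mem_cat xp orbT.
by case: (c) (x) => [d k] [y i]; rewrite /lexdiag /attack /=; lia.
Qed.

(** The number of places open to [c] when it is reinserted; for diagonals given by runs it becomes
    the l-schedule number of [c]. *)
Definition car_weight (u : seq car) (c : car) : nat :=
  if c.2 < 0 then count (attack^~ c) u
  else if c.2 == 0 then count (fun x => (x.2 == 0) && (c.1 <= x.1)%N) u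
  else count (attack c) u.

(** The hypothesis makes [p] hold exactly on an initial segment. *)
Lemma pairwise_filter_cat (T : eqType) (r : rel T) (p : pred T) (s : seq T) :
  (forall x y, r x y -> p y -> p x) -> pairwise r s ->
  s = filter p s ++ filter (predC p) s.
Proof.
move=> rp; elim: s => // x s IH /= /andP[/allP xs /IH {}IH].
case: (boolP (p x)) => px /=; first by congr (x :: _).
rewrite (_ : filter p s = [::]) /=; last first.
  apply/eqP; rewrite -[_ == _]negbK -has_filter; apply/negP => /hasP[y ys py].
  by rewrite (rp _ _ (xs y ys) py) in px.
by congr (x :: _); apply/esym/all_filterP/allP => y ys; apply: contra px => /(rp _ _ (xs y ys)).
Qed.

Lemma wsum_prod (N : nat) (u : seq car) :
  pairwise lexdiag u -> all (fun x => 0 < x.1 < N)%N u -> has (fun x => x.2 == 0) u ->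
  wsum q (valid N) u = \prod_(c <- u) qint q (car_weight u c).
Proof.
move=> pu uN u0.
have e1 := pairwise_filter_cat (p := fun x => 0 < x.2) _ pu.
set p := filter _ u in e1; set s := filter _ u in e1.
have {}e1 : u = p ++ s.
  by apply: e1 => -[a i] [b j]; rewrite /lexdiag /=; lia.
have ps : pairwise lexdiag s by exact: pairwise_filter.
have e2 : s = filter (fun x => x.2 == 0) s ++ filter (fun x => x.2 < 0) s.
  rewrite {1}[s](pairwise_filter_cat (p := fun x => 0 <= x.2) _ ps); last first.
    by move=> -[a i] [b j]; rewrite /lexdiag /=; lia.
  by congr (_ ++ _); rewrite -!filter_predI; apply: eq_filter => x /=; lia.
set z := filter _ s in e2; set m := filter _ s in e2.
have p0 : all (fun x => 0 < x.2) p by exact: filter_all.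
have z0 : all (fun x => x.2 == 0) z by exact: filter_all.
have m0 : all (fun x => x.2 < 0) m by exact: filter_all.
have zn0 : z != [::].
  case/hasP: u0 => x xu x0; rewrite -has_filter; apply/hasP; exists x => //.
  by rewrite mem_filter /= (eqP x0) xu.
(* The positive cars are peeled off at the front, then the negative ones at the back, and diagonal 0
   remains. *)
rewrite {1}e1 wsum_positive_part -?e1 //.
have sN : all (fun x => 0 < x.1 < N)%N s by move: uN; rewrite e1 all_cat => /andP[].
rewrite e2 wsum_negative_part -?e2 //.
rewrite wsum_diag0 //; first last.
- apply/allP => x xz; rewrite (allP z0) //= (allP sN) //.
  by rewrite e2 mem_cat xz.
- by move: ps; rewrite e2 pairwise_cat => /and3P[].
rewrite e1 e2 !big_cat /= [X in _ * X]mulrC; congr (_ * (_ * _)).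
- apply: eq_big_seq => c /(allP p0) cp; rewrite -e2 -e1 /car_weight.
  by rewrite ltNge ltW //= gt_eqF.
- apply: eq_big_seq => c /(allP z0)/eqP c0; rewrite -e2 -e1 /car_weight c0 ltxx eqxx.
  congr (qint q _); rewrite e1 e2 !count_cat.
  rewrite [X in (X + _)%N](eq_in_count (a2 := pred0)) => [|x /(allP p0)]; last by rewrite /=; lia.
  rewrite [X in (_ + (_ + X))%N](eq_in_count (a2 := pred0)) => [|x /(allP m0)]; last first.
    by rewrite /=; lia.
  by rewrite !count_pred0 addn0 add0n; apply: eq_in_count => x /(allP z0) ->.
- apply: eq_big_seq => c /(allP m0) c0; rewrite -e2 -e1 /car_weight c0.
  congr (qint q _); rewrite e1 count_cat.
  (* An attacker lies at most one diagonal above its target, so no positive car attacks a negative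
     one. *)
  rewrite [X in (X + _)%N](eq_in_count (a2 := pred0)) => [|x /(allP p0)]; last first.
    by case: (c) (x) c0 => [d k] [y i]; rewrite /attack /=; lia.
  by rewrite count_pred0.
Qed.

End Wsum.

(** * Runs and schedule numbers *)

Lemma runs_cons2 (x y : nat) (s : seq nat) :
  exists r rs, runs (y :: s) = (y :: r) :: rs /\
    runs (x :: y :: s) = if x < y then (x :: y :: r) :: rs else [:: x] :: (y :: r) :: rs.
Proof.
have [r [rs e]] : exists r rs, runs (y :: s) = (y :: r) :: rs.
  rewrite /=; case: (runs s) => [|[|z r] rs]; try by eexists; eexists.
  by case: ifP => _; eexists; eexists.
exists r, rs; split => //.
by rewrite -[runs (x :: y :: s)]/(match runs (y :: s) with
    | (y :: r) :: rs =>
        if x < y then (x :: y :: r) :: rs else [:: x] :: (y :: r) :: rs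
    | _ => [:: [:: x]] end) e.
Qed.

Lemma flatten_runs (s : seq nat) : flatten (runs s) = s.
Proof.
elim: s => // x [//|y s] IH.
have [r [rs [e ->]]] := runs_cons2 x y s.
by move: IH; rewrite e /= => <-; case: ifP.
Qed.

Lemma mem_runs_index (s : seq nat) (z : nat) :
  z \in s -> run_index s z < nruns s.
Proof.
move=> zs; rewrite /run_index /nruns -has_find.
by apply/hasP; move: zs; rewrite -{1}(flatten_runs s) => /flattenP[R]; exists R.
Qed.

Lemma nruns_cons2 (x y : nat) (s : seq nat) :
  nruns (x :: y :: s) = ~~ (x < y) + nruns (y :: s).
Proof.
rewrite /nruns; have [r [rs [-> ->]]] := runs_cons2 x y s.
by case: ifP.
Qed.

Lemma rie_head (x : nat) (s : seq nat) : rie (x :: s) x = (nruns (x :: s)).-1.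
Proof.
rewrite /rie /run_index; case: s => [|y s]; first by rewrite /= mem_head subn0.
have [r [rs [_ ->]]] := runs_cons2 x y s.
by case: ifP => _ /=; rewrite mem_head subn0.
Qed.

(** Numbering runs from the end makes the number of an old letter independent of letters put in
    front, which suits induction on the word. *)
Lemma rie_behead (x z : nat) (s : seq nat) :
  z \in s -> z != x -> rie (x :: s) z = rie s z.
Proof.
case: s => // y s zs zx; have := mem_runs_index zs.
rewrite /rie /run_index /nruns; have [r [rs [-> ->]]] := runs_cons2 x y s.
by case: ifP => _ /=; rewrite !inE (negPf zx) //=; case: ifP => //= _; lia.
Qed.

Lemma rie_cons2 (x y : nat) (s : seq nat) :
  rie (x :: y :: s) x = ~~ (x < y) + rie (y :: s) y.
Proof.
rewrite !rie_head nruns_cons2; have := mem_runs_index (mem_head y s).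
by case: nruns => // m _; rewrite addnS.
Qed.

Lemma attack_lexdiag (a b : car) : attack a b -> lexdiag a b.
Proof. by case: a b => [a i] [b j]; rewrite /attack /lexdiag /=; lia. Qed.

(** Within a run the label rises on one diagonal, and at a descent the diagonal drops by 1; both are
    attacks. *)
Lemma path_attack_rie (g : nat -> int) (x : nat) (s : seq nat) :
  uniq (x :: s) -> (forall z, z \in x :: s -> g z - g (last x s) = (rie (x :: s) z)%:Z)%R ->
  path attack (x, g x) [seq (z, g z) | z <- s].
Proof.
elim: s x => // y s IH x /andP[xs us] H /=.
have xy : x != y by apply: contraNneq xs => ->; rewrite mem_head.
have ry : rie (x :: y :: s) y = rie (y :: s) y by rewrite rie_behead ?mem_head // eq_sym.
apply/andP; split.
  have := H x (mem_head _ _); have := H y; rewrite ry rie_cons2 !inE eqxx orbT => /(_ isT).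
  by rewrite /attack /=; lia.
apply: IH => // z zs; rewrite -(rie_behead (x := x)) //; first by apply: H; rewrite inE zs orbT.
by apply: contraNneq xs => <-.
Qed.

(** An attack between neighbours keeps [g] at an ascent and lowers it by 1 at a descent, so [g] is
    the run number up to its value at the last letter. *)
Lemma rie_of_path_attack (g : nat -> int) (x : nat) (s : seq nat) :
  uniq (x :: s) -> path attack (x, g x) [seq (z, g z) | z <- s] ->
  forall z, z \in x :: s -> (g z - g (last x s) = (rie (x :: s) z)%:Z)%R.
Proof.
elim: s x => [|y s IH] x.
  by move=> _ _ z; rewrite inE => /eqP->; rewrite rie_head subrr.
move=> /andP[xs us] /andP[xy ys] z; have {IH} IH := IH y us ys.
rewrite inE => /predU1P[->|zs].
  have := IH y (mem_head _ _); rewrite rie_cons2 /=.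
  by move: xy; rewrite /attack /=; lia.
rewrite rie_behead ?IH //.
by apply: contraNneq xs => <-.
Qed.

(** Without repetitions every entry lies in a single block; this turns each run into a filter of the
    word. *)
Lemma nth_flatten (T : eqType) (bs : seq (seq T)) (i : nat) :
  uniq (flatten bs) ->
  nth [::] bs i = [seq x <- flatten bs | find (fun B : seq T => x \in B) bs == i].
Proof.
elim: bs i => [|b bs IH] i /=; first by rewrite nth_nil.
rewrite cat_uniq => /and3P[_ /hasPn nb ubs].
rewrite filter_cat; case: i => [|i] /=.
  rewrite (eq_in_filter (a2 := predT)) ?filter_predT => [|x ->] //.
  rewrite [X in _ = _ ++ X](eq_in_filter (a2 := pred0)) ?filter_pred0 ?cats0 //.
  by move=> x /nb /= /negPf ->.
rewrite (eq_in_filter (a2 := pred0)) ?filter_pred0 => [|x ->] //.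
by rewrite IH //; apply: eq_in_filter => x /nb /= /negPf ->.
Qed.

Lemma nth_runs (s : seq nat) (i : nat) :
  uniq s -> nth [::] (runs s) i = [seq x <- s | run_index s x == i].
Proof.
by move=> us; rewrite nth_flatten flatten_runs.
Qed.

(** * Runs of a word, numbered from the end *)

Section Tau.
Variable tau : seq nat.
Hypothesis tau_uniq : uniq tau.

Definition run (j : nat) : seq nat := [seq x <- tau | rie tau x == j].

Lemma nth_rev_runs (j : nat) : nth [::] (rev (runs tau)) j = run j.
Proof.
case: (ltnP j (size (runs tau))) => jr.
  rewrite nth_rev // nth_runs //; apply: eq_in_filter => x /mem_runs_index.
  by rewrite /rie /nruns; lia.
rewrite nth_default ?size_rev //; apply/esym/eqP; rewrite -[_ == _]negbK -has_filter.
apply/hasPn => x /mem_runs_index; rewrite /rie /nruns; lia.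
Qed.

Lemma rho_run (j : nat) : rho tau j = size (run j).
Proof. by rewrite /rho nth_rev_runs. Qed.

Lemma run_ofE (c : nat) : c \in tau -> run_of tau c = run (rie tau c).
Proof.
move=> ct; rewrite /run_of nth_runs //; apply: eq_in_filter => x /mem_runs_index.
by have := mem_runs_index ct; rewrite /rie; lia.
Qed.

Lemma next_runE (c : nat) : c \in tau ->
  next_run tau c = if rie tau c is j.+1 then run j else [::].
Proof.
move=> ct; rewrite /next_run.
have := mem_runs_index ct; case e: (rie tau c) => [|j] cr.
  by rewrite nth_default //; move: e cr; rewrite /rie /nruns; lia.
rewrite nth_runs //; apply: eq_in_filter => x /mem_runs_index.
by move: e cr; rewrite /rie; lia.
Qed.

(** The bound excludes the first run, where the truncated predecessor makes [prev_run] return that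
    run itself. *)
Lemma prev_runE (c : nat) : c \in tau -> rie tau c < (nruns tau).-1 ->
  prev_run tau c = run (rie tau c).+1.
Proof.
move=> ct cr; rewrite /prev_run nth_runs //; apply: eq_in_filter => x /mem_runs_index.
by have := mem_runs_index ct; move: cr; rewrite /rie; lia.
Qed.

Lemma mem_run (j x : nat) : (x \in run j) = (x \in tau) && (rie tau x == j).
Proof. by rewrite mem_filter andbC. Qed.

Lemma rie_last (x : nat) (s : seq nat) : uniq (x :: s) -> rie (x :: s) (last x s) = 0.
Proof.
elim: s x => [|y s IH] x us; first by rewrite rie_head.
move: us => /andP[xs us]; rewrite /= rie_behead ?IH //; first exact: mem_last.
by apply: contraNneq xs => <-; exact: mem_last.
Qed.

(** Consecutive letters attack by [path_attack_rie], and [attack] is contained in the transitive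
    relation [lexdiag]. *)
Lemma pairwise_lexdiag_rie (l : nat) :
  pairwise lexdiag [seq (c, ((rie tau c)%:Z - l%:Z)%R) | c <- tau].
Proof.
have := tau_uniq; rewrite -sorted_pairwise; last exact: lexdiag_trans.
case: tau => // x s us; apply: (sub_path attack_lexdiag).
apply: (path_attack_rie (g := fun c => ((rie (x :: s) c)%:Z - l%:Z)%R)) => //.
by move=> z zs; rewrite rie_last //; lia.
Qed.

Lemma run_sorted (j : nat) : pairwise ltn (run j).
Proof.
have /(pairwise_filter (fun c : car => (c.2 == j%:Z)%R)) := pairwise_lexdiag_rie 0.
rewrite filter_map (eq_filter (a2 := fun x => rie tau x == j)); last by move=> x /=; lia.
rewrite -/(run j) pairwise_map; apply: (sub_in_pairwise (P := mem (run j))); last exact/allP.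
move=> x y /=; rewrite !mem_filter /lexdiag /=; lia.
Qed.

Lemma tau_cat_run0 : tau = [seq x <- tau | rie tau x != 0] ++ run 0.
Proof.
have := pairwise_lexdiag_rie 0; rewrite pairwise_map => pt.
rewrite {1}(pairwise_filter_cat (p := fun x => rie tau x != 0) _ pt); last first.
  by move=> x y; rewrite /lexdiag /=; lia.
by congr (_ ++ _); apply: eq_filter => x; rewrite /= negbK.
Qed.

End Tau.

Lemma size_drop_index (s : seq nat) (c : nat) :
  pairwise ltn s -> c \in s -> size (drop (index c s) s) = count (fun x => c <= x) s.
Proof.
elim: s => // x s IH /= /andP[/allP xs /IH {}IH]; rewrite inE eq_sym.
case: eqVneq => [<- _|_ /= cs]; last by rewrite IH // leqNgt (xs _ cs : x < c).
rewrite /= leqnn add1n; congr _.+1; rewrite -(count_predT s).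
by apply/esym; apply: eq_in_count => y /xs /ltnW.
Qed.

(* Merging the two runs increasingly and reading elements of [s] as down-steps and elements of [t]
   as up-steps gives a lattice path from height [k + size s] to height [k + size t]; the two lists
   collect the lower heights of its down-steps and of its up-steps. *)
Lemma perm_two_runs (k : nat) (s t : seq nat) :
  pairwise ltn s -> pairwise ltn t -> {in s, forall x, x \notin t} ->
  perm_eq
    ([seq count (fun y => x < y) s + (k + count (fun y => y < x) t) | x <- s]
       ++ iota 0 (k + size t))
    ([seq k + count (fun y => y < x) t + count (fun y => x < y) s | x <- t]
       ++ iota 0 (k + size s)).
Proof.
have [m] := ubnP (size s + size t); elim: m k s t => // m IH k s t mst ps pt st.
have count0 (a : pred nat) u : {in u, forall y, ~~ a y} -> count a u = 0.
  by move=> au; rewrite (eq_in_count (a2 := pred0)) ?count_pred0 // => y /au /negPf.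
have countT (a : pred nat) u : {in u, forall y, a y} -> count a u = size u.
  by move=> au; rewrite (eq_in_count (a2 := predT)) ?count_predT // => y /au.
have iotaSr j : iota 0 j.+1 = rcons (iota 0 j) j by rewrite -addn1 iotaD cats1.
(* The path starts with a down-step to height [k + size s'], which is the top entry of
   [iota 0 (k + size s)]; the rest has the same base [k]. *)
have x_first x s' : s = x :: s' -> {in t, forall y, x < y} -> perm_eq
    ([seq count (fun y => x < y) s + (k + count (fun y => y < x) t) | x <- s]
       ++ iota 0 (k + size t))
    ([seq k + count (fun y => y < x) t + count (fun y => x < y) s | x <- t]
       ++ iota 0 (k + size s)).
  move=> es xt; rewrite es in mst ps st *; case/andP: ps => /allP xs ps.
  rewrite /= ltnn add0n (countT _ s') // (count0 _ t) => [|y /xt]; last by rewrite -leqNgt => /ltnW.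
  rewrite addn0 addnS iotaSr -rcons_cat perm_sym perm_rcons perm_sym addnC perm_cons.
  rewrite (eq_in_map _ (fun z => count (fun y => z < y) s' + (k + count (fun y => y < z) t)) s').1;
    last first.
    by move=> z /xs xz; rewrite ltnNge (ltnW xz).
  rewrite (eq_in_map _
     (fun z => k + count (fun y => y < z) t + count (fun y => z < y) s') t).1; last first.
    by move=> z /xt xz; rewrite ltnNge (ltnW xz).
  by apply: IH => // z zs; apply: st; rewrite inE zs orbT.
(* The path starts with an up-step from height [k + size s], which extends [iota 0 (k + size s)] by
   one entry; the rest has base [k.+1]. *)
have y_first y t' : t = y :: t' -> {in s, forall x, y < x} -> perm_eq
    ([seq count (fun y => x < y) s + (k + count (fun y => y < x) t) | x <- s]
       ++ iota 0 (k + size t))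
    ([seq k + count (fun y => y < x) t + count (fun y => x < y) s | x <- t]
       ++ iota 0 (k + size s)).
  move=> et ys; rewrite et in mst pt st *; case/andP: pt => /allP yt pt.
  rewrite /= ltnn add0n (countT _ s) // (count0 _ t') => [|z /yt]; last by rewrite -leqNgt => /ltnW.
  rewrite addn0 addnS.
  rewrite (eq_in_map _
     (fun z => count (fun x => z < x) s + (k.+1 + count (fun x => x < z) t')) s).1; last first.
    by move=> z /ys ->; rewrite add1n addnS.
  rewrite (eq_in_map _
     (fun z => k.+1 + count (fun x => x < z) t' + count (fun x => z < x) s) t').1; last first.
    by move=> z /yt /= ->; rewrite add1n addnS.
  have := IH k.+1 s t'; rewrite !addSn iotaSr => /(_ _ ps pt _)/permPl H.
  rewrite H; last 2 first.
  - by move: mst; rewrite /= addnS.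
  - by move=> z /st; rewrite inE negb_or => /andP[].
  by rewrite iotaSr -rcons_cat perm_rcons.
case es: s => [|x s'].
  case et: t => [|y t'] //.
  by rewrite -es -et; apply: (y_first y t') => //; rewrite es.
case et: t => [|y t'].
  by rewrite -es -et; apply: (x_first x s') => //; rewrite et.
have xy : x != y.
  by apply: contraTneq (st x _) => [->|]; rewrite ?es ?et ?mem_head.
rewrite -es -et; case: (ltngtP x y) xy => // xy _.
  apply: (x_first x s') => // z; rewrite et inE => /predU1P[->//|zt].
  by apply: ltn_trans xy _; move: pt; rewrite et => /andP[/allP+ _]; apply.
apply: (y_first y t') => // z; rewrite es inE => /predU1P[->//|zt].
by apply: ltn_trans xy _; move: ps; rewrite es => /andP[/allP+ _]; apply.
Qed.

Lemma count_sum_filter (T : Type) (a : pred T) (h : T -> nat) (m : nat) (s : seq T) :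
  all (fun x => h x < m) s -> count a s = \sum_(j < m) count a [seq x <- s | h x == j].
Proof.
elim: s => [|x s IH] /=; first by rewrite big1.
move=> /andP[xm /IH ->]; rewrite (bigD1 (Ordinal xm)) //= [RHS](bigD1 (Ordinal xm)) //=.
rewrite eqxx /= addnA; congr (_ + _); apply: eq_bigr => i ix.
by rewrite (_ : h x == i = false) //; apply: contraNF ix => /eqP e; apply/eqP/val_inj.
Qed.

(** * The multiset of l-schedule numbers *)

Section ScheduleMultiset.
Variables (tau : seq nat) (l : nat).
Hypothesis tau_uniq : uniq tau.

Let run := run tau.
(** Both lists compare the neighbouring runs [j.+1] and [j]: [down j] holds the ordinary schedule
    numbers of run [j.+1], and [up j] the l-schedule numbers of run [j] for [j < l]. *)
Let down j :=
  [seq count (fun y => x < y) (run j.+1) + count (fun y => y < x) (run j) | x <- run j.+1].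
Let up j :=
  [seq count (fun y => y < x) (run j) + count (fun y => x < y) (run j.+1) | x <- run j].

Lemma sched_numE (c j : nat) : c \in run j.+1 ->
  sched_num tau c = count (fun y => c < y) (run j.+1) + count (fun y => y < c) (run j).
Proof.
rewrite mem_run => /andP[ct /eqP cj].
by rewrite /sched_num run_ofE // next_runE // cj.
Qed.

Lemma map_count_geq (s : seq nat) : pairwise ltn s ->
  perm_eq [seq count (fun y => x <= y) s | x <- s] (iota 1 (size s)).
Proof.
elim: s => // x s IH /andP[/allP xs /IH {}IH].
have -> : iota 1 (size (x :: s)) = rcons (iota 1 (size s)) (size s).+1.
  by rewrite [size _]/= -(addn1 (size s)) iotaD cats1 add1n addn1.
rewrite /= leqnn (eq_in_count (a2 := predT)) => [|y /xs /ltnW //].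
rewrite count_predT add1n perm_sym perm_rcons perm_cons perm_sym.
rewrite (eq_in_map _ (fun z => count (fun y => z <= y) s) s).1 // => y /xs /= xy.
by rewrite leqNgt xy.
Qed.

(** Adding up [perm_two_runs] with base 0 over the first [l] pairs of neighbouring runs, the
    intermediate [iota] terms cancel. Multisets are compared by counting an arbitrary predicate. *)
Lemma telescope (a : pred nat) :
  (\sum_(j < l) count a (down j)) + count a (iota 0 (size (run 0))) =
  (\sum_(j < l) count a (up j)) + count a (iota 0 (size (run l))).
Proof.
elim: l => [|m IH]; first by rewrite !big_ord0.
rewrite !big_ord_recr /=.
have st : {in run m.+1, forall x, x \notin run m}.
  by move=> x; rewrite !mem_run => /andP[_ /eqP->]; rewrite negb_and orbC; lia.
have /permP/(_ a) := perm_two_runs 0 (run_sorted tau_uniq m.+1) (run_sorted tau_uniq m) st.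
rewrite !count_cat.
under eq_map => x do rewrite add0n.
under [in RHS]eq_map => x do rewrite add0n.
rewrite -/(down m) -/(up m) !add0n => T.
by rewrite addnAC IH -addnA [X in _ + X]addnC T addnA.
Qed.

Lemma count_map_runs (a : pred nat) (f : nat -> nat) :
  count a [seq f c | c <- tau] = \sum_(j < nruns tau) count a [seq f c | c <- run j].
Proof.
rewrite count_map (count_sum_filter _ (h := rie tau) (m := nruns tau)).
  by apply: eq_bigr => j _; rewrite count_map.
apply/allP => x /mem_runs_index; rewrite /rie; lia.
Qed.

Lemma count_schedule (a : pred nat) :
  count a (schedule tau) =
    count a (iota 1 (size (run 0))) + \sum_(j < (nruns tau).-1) count a (down j).
Proof.
rewrite /schedule; have -> : size (last [::] (runs tau)) = size (run 0).
  rewrite /run -nth_rev_runs //; case/lastP: (runs tau) => [|s x] //.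
  by rewrite rev_rcons last_rcons.
set b := [seq x <- tau | rie tau x != 0].
have tauE : tau = b ++ run 0 by exact: tau_cat_run0.
have sz : size tau = size (run 0) + size b by rewrite {1}tauE size_cat addnC.
cbv zeta; rewrite [in iota _ _]sz iotaD map_cat count_cat; congr (_ + _).
  rewrite (eq_in_map _ id _).1 ?map_id // => i.
  by rewrite mem_iota add1n ltnS => /andP[_ ->].
(* The positions after the first [rho tau 0] ones read the word without its last run backwards. *)
rewrite (_ : map _ _ = rev [seq sched_num tau x | x <- b]); last first.
  apply: (@eq_from_nth _ 0); rewrite ?size_rev !size_map size_iota // => i ib.
  rewrite (nth_map 0) ?size_iota // nth_iota // nth_rev ?size_map // (nth_map 0); last by lia.
  rewrite leqNgt add1n addSn ltnS leq_addr /= {2}tauE nth_cat; case: ifP; last by lia.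
  by move=> _; congr (sched_num tau (nth 0 b _)); lia.
rewrite count_rev count_map (count_sum_filter _ (h := rie tau) (m := nruns tau)).
  case e: (nruns tau) => [|m]; first by rewrite !big_ord0.
  rewrite big_ord_recl /= (_ : [seq x <- b | rie tau x == 0] = [::]).
    rewrite add0n; apply: eq_bigr => j _; rewrite -filter_predI count_map.
    rewrite (_ : filter _ _ = run j.+1).
      by apply: eq_in_count => x /sched_numE /= ->.
    by apply: eq_filter => x /=; rewrite /bump /=; case: eqP => // ->.
  by rewrite -filter_predI (eq_filter (a2 := pred0)) ?filter_pred0 // => x /=; case: eqP.
apply/allP => x; rewrite mem_filter => /andP[_ /mem_runs_index].
by rewrite /rie; lia.
Qed.

Hypothesis l_lt : l < nruns tau.

Lemma lschedE (c j : nat) : c \in run j ->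
  lsched tau l c =
    if j < l then count (fun y => y < c) (run j) + count (fun y => c < y) (run j.+1)
    else if j == l then count (fun y => c <= y) (run l)
    else count (fun y => c < y) (run j) + count (fun y => y < c) (run j.-1).
Proof.
move=> cj; move: (cj); rewrite mem_run => /andP[ct /eqP ej].
rewrite /lsched ej run_ofE // ej -/run.
case: ltngtP => [jl|jl|jl].
- rewrite prev_runE // ej //; apply: leq_trans jl _.
  by rewrite -ltnS prednK //; exact: leq_ltn_trans l_lt.
- by case: j jl cj {ej} => // j jl cj; rewrite (sched_numE cj).
- by rewrite -jl size_drop_index //; exact: run_sorted.
Qed.

(** Adding [rho tau 0] on the left replaces the multiset difference. The runs to the left of run [l]
    contribute equally to both sides; [telescope] compares the others. *)
Lemma perm_lsched :
  perm_eq (rho tau 0 :: [seq lsched tau l c | c <- tau]) (rho tau l :: schedule tau).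
Proof.
apply/permP => a; rewrite /= count_map_runs count_schedule !rho_run //.
have T := telescope a.
(* [telescope] involves 0, ..., m-1 whereas the schedules involve 1, ..., m; trading 0 for m is what
   makes [rho tau 0] and [rho tau l] appear. *)
have e0 m : a m + count a (iota 0 m) = a 0 + count a (iota 1 m).
  have : count a (iota 0 m.+1) = a 0 + count a (iota 1 m) by [].
  by rewrite -(addn1 m) iotaD count_cat add0n /= => <-; lia.
have := e0 (size (run 0)); have := e0 (size (run l)).
have lt_l : l < nruns tau by exact: l_lt.
have -> : \sum_(j < nruns tau) count a [seq lsched tau l c | c <- run j] =
   \sum_(j < l) count a (up j) + count a (iota 1 (size (run l))) +
   \sum_(l <= j < (nruns tau).-1) count a (down j).
  rewrite -(big_mkord xpredT (fun j => count a [seq lsched tau l c | c <- run j])).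
  rewrite (big_cat_nat _ (n := l)) ?(ltnW l_lt) //= -addnA; congr (_ + _).
    rewrite big_mkord; apply: eq_bigr => j _; congr count.
    by apply/eq_in_map => c /lschedE ->; rewrite ltn_ord.
  rewrite big_ltn //; congr (_ + _).
    rewrite -(permP (map_count_geq (run_sorted tau_uniq l))); congr count.
    by apply/eq_in_map => c /lschedE ->; rewrite ltnn eqxx.
  rewrite -(prednK (leq_ltn_trans (leq0n _) l_lt)) big_add1 /=.
  apply: eq_big_nat => j /andP[lj _]; congr count.
  by apply/eq_in_map => c /lschedE ->; rewrite ltnNge leqW // gtn_eqF.
have -> : \sum_(j < (nruns tau).-1) count a (down j) =
   \sum_(j < l) count a (down j) + \sum_(l <= j < (nruns tau).-1) count a (down j).
  rewrite -!(big_mkord xpredT (fun j => count a (down j))) -big_cat_nat //.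
  by move: l_lt; case: nruns.
have arith (d u x c0 cl i0 il r0 rl z : nat) : d + c0 = u + cl -> rl + cl = z + il ->
    r0 + c0 = z + i0 -> r0 + (u + il + x) = rl + (i0 + (d + x)) by lia.
move=> e1 e2; exact: (arith _ _ _ _ _ _ _ _ _ _ T e1 e2).
Qed.

End ScheduleMultiset.

(** Diagonals are run numbers minus [l], so one diagonal higher or lower means the previous or next
    run, and the three signs of the diagonal give the three cases of [lsched]. *)
Lemma car_weight_lsched (tau : seq nat) (l c : nat) :
  uniq tau -> l < nruns tau -> c \in tau ->
  let g x := ((rie tau x)%:Z - l%:Z)%R in
  car_weight [seq (x, g x) | x <- tau] (c, g c) = lsched tau l c.
Proof.
move=> ut lt ct g; set j := rie tau c.
have cj : c \in run tau j by rewrite mem_run ct eqxx.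
rewrite (lschedE ut lt cj) /car_weight /= !count_map.
have split_count i k (a b : pred nat) : i != k ->
    count (fun x => (rie tau x == i) && a x || (rie tau x == k) && b x) tau =
    count a (run tau i) + count b (run tau k).
  move=> ik; rewrite !count_filter -count_predUI.
  rewrite [X in _ = _ + X](eq_count (a2 := pred0)) ?count_pred0 ?addn0.
    by apply: eq_count => x /=; rewrite andbC [b x && _]andbC.
  by move=> x /=; apply/negP => /andP[/andP[_ /eqP->] /andP[_]]; exact/negP.
have gj : g c = (j%:Z - l%:Z)%R by [].
case: (ltngtP j l) => jl.
- rewrite (_ : (g c < 0)%R = true); last by rewrite gj; lia.
  rewrite -split_count; last by lia.
  by apply: eq_count => x; rewrite /= /attack /= gj /g; lia.
- have -> : (g c < 0)%R = false by rewrite gj; lia.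
  have -> : (g c == 0)%R = false by rewrite gj; lia.
  rewrite -split_count; last by lia.
  apply: eq_count => x; rewrite /= /attack /= gj /g; lia.
- rewrite gj jl subrr ltxx eqxx count_filter.
  by apply: eq_count => x; rewrite /= /g; lia.
Qed.

(** * Preference functions as orders on cars *)

Lemma index_pairwise (T : eqType) (r : rel T) (s : seq T) (x : T) :
  irreflexive r -> transitive r -> pairwise r s -> x \in s -> index x s = count (r^~ x) s.
Proof.
move=> ri rt; elim: s => // y s IH /= /andP[/allP ys /IH {}IH]; rewrite inE eq_sym.
have ra a b : r a b -> r b a = false.
  by move=> rab; apply/negP => rba; have := rt _ _ _ rab rba; rewrite ri.
case: eqVneq => [<- _|_ /= xs].
  rewrite ri (eq_in_count (a2 := pred0)) ?count_pred0 // => z /ys; exact: ra.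
by rewrite IH // ys.
Qed.

(** Once the order is carried by [r] in the summand, the sums can be taken over the cars in any
    order. *)
Lemma attacks_double_sum (T : eqType) (r : rel T) (h : T -> car) (s : seq T) :
  irreflexive r -> transitive r -> pairwise r s ->
  attacks (map h s) = \sum_(a <- s) \sum_(b <- s) (r a b && attack (h a) (h b)).
Proof.
move=> ri rt; elim: s => [|x s IH] /=; first by rewrite big_nil.
move=> /andP[/allP xs /IH {}IH].
rewrite !big_cons ri /= add0n; congr (_ + _).
  rewrite count_map -sum1_count big_mkcond; apply: eq_big_seq => y /xs -> /=.
  by case: attack.
rewrite IH; apply: eq_big_seq => a /xs xa; rewrite big_cons.
by rewrite (_ : r a x = false) //; apply/negP => ax; have := rt _ _ _ xa ax; rewrite ri.
Qed.

Lemma perm_flatten_filter (T U : eqType) (h : T -> U) (r : seq U) (s : seq T) :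
  uniq r -> all (fun x => h x \in r) s ->
  perm_eq (flatten [seq [seq x <- s | h x == d] | d <- r]) s.
Proof.
elim: r s => [|d r IH] s /=; first by case: s.
move=> /andP[dr ur] sr; apply: perm_trans (permEl (perm_filterC (fun x => h x == d) s)).
rewrite perm_cat2l perm_sym -(permPl (IH _ ur _)); last first.
  apply/allP => x; rewrite mem_filter => /andP[/= xd xs].
  by have := allP sr _ xs; rewrite inE (negPf xd).
apply/permP => a; congr (count a (flatten _)); apply/eq_in_map => e er.
rewrite -filter_predI; apply: eq_filter => x /=.
by case: eqP => //= ->; apply: contraNneq dr => <-.
Qed.

(** A discrete intermediate value argument: rises are by 1, so getting from below [m] up to [m] uses
    a step from [m - 1] to [m], which increases the label. *)
Lemma crossing (m : int) (x : car) (s : seq car) :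
  path step x s -> (x.2 < m <= (last x s).2)%R ->
  exists a b : car, [/\ a \in x :: s, b \in x :: s, a.2 = m, (b.2 = m - 1)%R & b.1 < a.1].
Proof.
elim: s x => [|y s IH] x /=; first by lia.
move=> /andP[xy ys] xm; case: (ltP y.2 m) => ym.
  have [|a [b [aI bI ? ? ?]]] := IH y ys; first by lia.
  by exists a, b; split=> //; rewrite inE ?aI ?bI orbT.
exists y, x; rewrite !inE !eqxx orbT; move: xy xm ym; rewrite /step; split => //; lia.
Qed.

Lemma valid_cons (N : nat) (x : car) (s : seq car) :
  all (fun a => 0 < a.1 < N) (x :: s) ->
  valid N (x :: s) = [&& (x.2 <= 0)%R, path step x s & (0 <= (last x s).2)%R].
Proof.
move=> /= /andP[xN sN]; rewrite /valid /= rcons_path.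
have lN : 0 < (last x s).1 < N.
  by have := mem_last x s; rewrite inE => /predU1P[->//|]; exact: (allP sN).
by congr [&& _, _ & _]; move: xN lN; rewrite /step /=; lia.
Qed.

(** If the diagonal drops between neighbours [x] and [y] of [u], then [crossing] puts some [b] in
    the diagonal just below [x], smaller than some [a] in that of [x]. Hence [y] lies in the
    diagonal of [b]. *)
Lemma sorted_attack (N : nat) (u v : seq car) :
  pairwise lexdiag u -> perm_eq u v -> all (fun a => 0 < a.1 < N) v -> valid N v ->
  sorted attack u.
Proof.
move=> pu uv vN vv.
have level (x y : car) : x \in u -> y \in u -> (y.2 < x.2)%R ->
    exists a b : car, [/\ a \in u, b \in u, a.2 = x.2, (b.2 = x.2 - 1)%R & b.1 < a.1].
  rewrite !(perm_mem uv) => xv yv yx.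
  case: v vN vv xv yv uv => // z v vN; rewrite valid_cons // => /and3P[z0 pv l0] xv yv uv.
  have ex (w w1 : car) s : path step w s -> (w.2 < w1.2 <= (last w s).2)%R ->
      {subset w :: s <= z :: v} ->
      exists a b : car, [/\ a \in u, b \in u, a.2 = w1.2, (b.2 = w1.2 - 1)%R & b.1 < a.1].
    move=> ps ws sv; have [a [b [aI bI ? ? ?]]] := crossing ps ws.
    by exists a, b; split; rewrite ?(perm_mem uv) ?sv.
  (* A diagonal at most 0 is reached on the way from [y] to the last car, a positive one on the way
     from the first car to [x]. *)
  case: (lerP x.2 0) => x0.
    case/splitPl: yv pv l0 ex => p1 p2 yE; rewrite cat_path last_cat yE => /andP[_ p2y] l0 ex.
    apply: (ex y x p2) => //; first by rewrite yx (le_trans x0 l0).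
    by move=> w; rewrite -yE inE -cat_cons mem_cat => /predU1P[->|->];
      rewrite ?orbT // mem_last.
  case/splitPl: xv pv l0 ex => p1 p2 xE; rewrite cat_path => /andP[p1x _] _ ex.
  apply: (ex z x p1) => //; first by rewrite xE lexx (le_lt_trans z0 x0).
  by move=> w; rewrite -cat_cons mem_cat => ->.
have H (s p : seq car) (x : car) : u = p ++ x :: s -> path attack x s.
  elim: s p x => // y s IH p x uE; rewrite /= (IH (rcons p x)) ?cat_rcons // andbT.
  move: pu; rewrite uE pairwise_cat /= => /and3P[/allrelP px pp /and3P[/andP[xy xs] ys ps]].
  case: (ltP y.2 x.2) => yx; last by move: xy yx; rewrite /lexdiag /attack; lia.
  have [||a [b [au bu ax bx ba]]] := level x y _ _ yx.
  - by rewrite uE mem_cat mem_head orbT.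
  - by rewrite uE mem_cat !inE eqxx !orbT.
  (* As [x] ends its diagonal and [y] begins the next, [y.1 <= b.1 < a.1 <= x.1]. *)
  have a_le : a.1 <= x.1.
    move: au; rewrite uE mem_cat !inE => /or4P[ap|/eqP->//|/eqP ay|as_].
    - by have := px _ _ ap (mem_head x _); rewrite /lexdiag ax; lia.
    - by move: ax yx; rewrite ay; lia.
    - by have := allP ys _ as_; rewrite /lexdiag ax; lia.
  have [yb y2] : y.1 <= b.1 /\ y.2 = b.2.
    move: bu; rewrite uE mem_cat !inE => /or4P[bp|/eqP bE|/eqP->//|bs].
    - by have := px _ _ bp (mem_head x _); rewrite /lexdiag bx; lia.
    - by move: bx; rewrite bE; lia.
    - by have := allP ys _ bs; rewrite /lexdiag; move: bx yx; lia.
  by rewrite /attack; lia.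
case: u {pu uv level} H => // x s H; exact: (H s [::]).
Qed.

(** * The row order of a preference function *)

Section PrefCars.
Variable n : nat.
Implicit Types (f : {ffun 'I_n -> 'I_n}) (i j : 'I_n).

Definition below f i j : bool := (f i < f j) || ((f i == f j) && (i < j)).

(** Sorting needs a total relation, hence the negated converse of the strict order [below]. *)
Definition row_order f : seq 'I_n := sort (fun i j => ~~ below f j i) (enum 'I_n).

Definition car_of (g : 'I_n -> int) i : car := (i.+1, g i).

Definition cars f : seq car := map (car_of (pdiag f)) (row_order f).

Lemma below_irr f : irreflexive (below f).
Proof. by move=> i; rewrite /below !ltnn andbF. Qed.

Lemma below_trans f : transitive (below f).
Proof. by move=> j i k; rewrite /below -!val_eqE /=; lia. Qed.

Lemma below_total f i j : i != j -> below f j i = ~~ below f i j.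
Proof. by rewrite /below -!val_eqE /=; lia. Qed.

Lemma row_order_perm f : perm_eq (row_order f) (enum 'I_n).
Proof. by rewrite perm_sort. Qed.

Lemma mem_row_order f i : i \in row_order f.
Proof. by rewrite (perm_mem (row_order_perm f)) mem_enum. Qed.

Lemma row_order_uniq f : uniq (row_order f).
Proof. by rewrite (perm_uniq (row_order_perm f)) enum_uniq. Qed.

Lemma size_row_order f : size (row_order f) = n.
Proof. by rewrite (perm_size (row_order_perm f)) size_enum_ord. Qed.

Lemma row_order_pairwise f : pairwise (below f) (row_order f).
Proof.
have tot : total (fun i j => ~~ below f j i).
  by move=> i j; rewrite /below -!val_eqE /=; lia.
have tr : transitive (fun i j => ~~ below f j i).
  by move=> j i k; rewrite /below -!val_eqE /=; lia.
have := sort_sorted tot (enum 'I_n); rewrite sorted_pairwise // => p1.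
have := row_order_uniq f; rewrite uniq_pairwise => p2.
have : pairwise [rel i j | ~~ below f j i && (i != j)] (row_order f).
  by rewrite pairwise_relI p1.
apply: sub_pairwise => i j /= /andP[ji ij].
by rewrite -[below f i j]negbK -below_total.
Qed.

Lemma row_order_eq f s :
  pairwise (below f) s -> perm_eq s (enum 'I_n) -> row_order f = s.
Proof.
move=> ps sn; apply: (pairwise_eq (r := below f)) => //.
- by move=> i j /andP[/below_trans H /H]; rewrite below_irr.
- exact: row_order_pairwise.
- by apply: perm_trans (row_order_perm f) _; rewrite perm_sym.
Qed.

Lemma prow_index f i : prow f i = index i (row_order f).
Proof.
rewrite (index_pairwise (below_irr f) (@below_trans f) (row_order_pairwise f)) ?mem_row_order //.
rewrite /prow cardsE cardE /enum_mem size_filter (permP (row_order_perm f)) enumT.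
by apply: eq_count => j.
Qed.

Lemma cars_bounds (g : 'I_n -> int) (s : seq 'I_n) :
  all (fun a => 0 < a.1 < n.+1) (map (car_of g) s).
Proof. by apply/allP => _ /mapP[i _ ->] /=; rewrite ltnS ltn_ord. Qed.

(** The row goes up by 1 and the column does not decrease, so the diagonal rises by at most 1, and
    only inside a column. The first car is in row 0, the last one in row [n.-1], and columns range
    from 0 to [n.-1]. *)
Lemma valid_cars f : 0 < n -> valid n.+1 (cars f).
Proof.
move=> n0; have := cars_bounds (pdiag f) (row_order f); rewrite -/(cars f) /cars.
case e: (row_order f) => [|x s].
  by have := size_row_order f; rewrite e /= => sz; rewrite -[X in _ < X]sz in n0.
move=> cb; rewrite valid_cons //=; apply/and3P; split.
- by rewrite /pdiag prow_index e index_head; lia.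
- have H : sorted (relpre (car_of (pdiag f)) step) (row_order f).
    apply/(sortedP x) => i iS.
    have iI : i < size (row_order f) by exact: ltnW.
    have := pairwiseP x (row_order_pairwise f) i i.+1 iI iS (ltnSn i).
    rewrite /= /step /= /pdiag !prow_index !index_uniq ?row_order_uniq // /below /pcol.
    by rewrite -val_eqE /=; lia.
  by move: H; rewrite e /= path_map.
- rewrite last_map /= /pdiag prow_index /pcol.
  have -> : index (last x s) (row_order f) = n.-1.
    rewrite e -[last x s]/(last x (x :: s)) -nth_last -e size_row_order index_uniq //.
      by rewrite size_row_order; move: n0; case: (n).
    exact: row_order_uniq.
  by have := ltn_ord (f (last x s)); lia.
Qed.

Lemma pdinv_attacks f : pdinv f = attacks (cars f) + #|[set i | (pdiag f i < 0)%R]|.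
Proof.
rewrite /pdinv; congr (_ + _).
rewrite (attacks_double_sum _ (below_irr f) (@below_trans f) (row_order_pairwise f)).
under eq_bigr do rewrite (perm_big _ (row_order_perm f)) big_enum /=.
rewrite (perm_big _ (row_order_perm f)) big_enum /= pair_bigA /=.
rewrite -!sum1dep_card [X in X + _]big_mkcond [X in _ + X]big_mkcond -big_split /=.
apply: eq_bigr => -[i j] _ /=.
(* Cars of one column lie on different diagonals, so the tie case of [below] never combines with
   [attack]. *)
have rij : f i = f j -> i < j -> prow f i < prow f j.
  move=> fij ij; rewrite /prow; apply: proper_card; apply/properP; split.
    by apply/subsetP => k; rewrite !inE fij; lia.
  by exists i; rewrite !inE fij eqxx !ltnn /= ?ij.
have fv : (f i == f j) = (f i == f j :> nat) by rewrite -val_eqE.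
have {}rij : (f i == f j :> nat) -> i < j -> prow f i < prow f j.
  by rewrite -fv => /eqP; exact: rij.
rewrite /below /attack /= fv !ltnS; move: rij; rewrite /pdiag /pcol.
have ifE (b : bool) : (if b then 1 else 0) = b by case: b.
rewrite !ifE; move: (f i : nat) (f j : nat) (prow f i) (prow f j) (i : nat) (j : nat).
by move=> ci cj ri rj {fv}i {}j; lia.
Qed.

Lemma pdev_eq f (h : 'I_n -> nat) (l : nat) :
  (forall i, pdiag f i = (h i)%:Z - l%:Z)%R -> (exists i, h i = 0) -> pdev f = l.
Proof.
move=> H [i0 hi0]; apply/eqP; rewrite /pdev eqn_leq; apply/andP; split.
  by apply/bigmax_leqP => i _; move: (H i); rewrite /pdiag; lia.
apply: leq_trans (leq_bigmax (F := fun c => pcol f c - prow f c) i0).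
by move: (H i0); rewrite /pdiag hi0; lia.
Qed.

Definition diag_cars f : seq car :=
  flatten [seq [seq car_of (pdiag f) i | i <- enum 'I_n & pdiag f i == d] | d <- diag_range n].

Lemma diagword_cars f : diagword f = map fst (diag_cars f).
Proof.
rewrite /diag_cars map_flatten -map_comp; congr flatten; apply: eq_map => d /=.
by rewrite -map_comp.
Qed.

Lemma diag_range_pdiag f i : pdiag f i \in diag_range n.
Proof.
have pn : prow f i < n.
  by rewrite prow_index -[X in _ < X](size_row_order f) index_mem mem_row_order.
have := ltn_ord (f i); rewrite /diag_range /pdiag /pcol => fn.
apply/mapP; exists (n.-1 + f i - prow f i); first by rewrite mem_iota; lia.
lia.
Qed.

Lemma diag_range_pairwise : pairwise (fun a b : int => (b < a)%R) (diag_range n).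
Proof.
rewrite /diag_range pairwise_map.
apply: sub_pairwise (_ : pairwise ltn (iota 0 _)) => [a b|]; first by rewrite /= ; lia.
by rewrite -sorted_pairwise ?iota_ltn_sorted //; exact: ltn_trans.
Qed.

Lemma diag_cars_perm f : perm_eq (diag_cars f) (map (car_of (pdiag f)) (enum 'I_n)).
Proof.
rewrite /diag_cars (map_comp (map (car_of (pdiag f)))) -map_flatten; apply: perm_map.
apply: perm_flatten_filter; last by apply/allP => i _; exact: diag_range_pdiag.
by apply: pairwise_uniq diag_range_pairwise => x; rewrite ltxx.
Qed.

Lemma diag_cars_pairwise f : pairwise lexdiag (diag_cars f).
Proof.
rewrite /diag_cars; elim: (diag_range n) diag_range_pairwise => //= d r IH /andP[/allP dr pr].
rewrite pairwise_cat IH // andbT; apply/andP; split.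
  apply/allrelP => _ b /mapP[i + ->] /flattenP[_ /mapP[e er ->]] /mapP[j + ->].
  rewrite !mem_filter => /andP[/eqP di _] /andP[/eqP dj _].
  by rewrite /lexdiag /= di dj dr.
rewrite pairwise_map; apply: (sub_in_pairwise (P := fun i => pdiag f i == d)).
- by move=> i j /eqP di /eqP dj; rewrite /lexdiag /= di dj eqxx ltxx; exact: id.
- exact: filter_all.
apply: pairwise_filter; rewrite -(pairwise_map val ltn) val_enum_ord.
by rewrite -sorted_pairwise ?iota_ltn_sorted //; exact: ltn_trans.
Qed.

(** The column must be the row, that is the position in [s], minus the diagonal. The steps of
    [valid] make [s] sorted by column and then label. *)
Lemma row_order_surj (g : 'I_n -> int) (s : seq 'I_n) :
  perm_eq s (enum 'I_n) -> valid n.+1 (map (car_of g) s) ->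
  exists2 f : {ffun 'I_n -> 'I_n}, row_order f = s & pdiag f =1 g.
Proof.
move=> sn sv; have us : uniq s by rewrite (perm_uniq sn) enum_uniq.
have sz : size s = n by rewrite (perm_size sn) size_enum_ord.
have ms i : i \in s by rewrite (perm_mem sn) mem_enum.
pose col i : int := ((index i s)%:Z - g i)%R.
pose le i j := (col i < col j)%R || ((col i == col j) && (i < j)).
have le_trans : transitive le by move=> j i k; rewrite /le /col; lia.
have ps : pairwise le s.
  case: s us sz ms sv sn @col @le le_trans => // x s us sz ms + _ col le le_trans.
  rewrite (valid_cons (cars_bounds g (x :: s))) => /and3P[_ + _].
  rewrite path_map -[path _ _ _]/(sorted (relpre (car_of g) step) (x :: s)) => ss.
  rewrite -sorted_pairwise //; apply/(sortedP x) => i iS.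
  have := sortedP x ss i iS; rewrite /le /col !index_uniq //; last exact: ltnW.
  by rewrite /step /=; lia.
(* Columns increase weakly along [s], so the two end conditions of [valid] bound all of them. *)
have col_bounds i : (0 <= col i < n%:Z)%R.
  have head_le : forall x s', s = x :: s' -> (0 <= col x <= col i)%R.
    move=> x s' e; move: sv; rewrite e (valid_cons (cars_bounds g (x :: s'))) => /and3P[gx _ _].
    have cx : col x = (- g x)%R by rewrite /col e index_head; lia.
    apply/andP; split; first by rewrite cx; move: gx => /=; lia.
    have := ms i; rewrite e inE => /predU1P[->//|ix].
    by move: ps; rewrite e => /andP[/allP/(_ _ ix) + _]; rewrite /le; lia.
  have last_ge : forall x s', s = rcons s' x -> (col i <= col x < n%:Z)%R.
    move=> x s' e; have : (0 <= g x)%R.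
      move: sv; rewrite e; case: (s') => [|y t].
        by rewrite (valid_cons (cars_bounds g [:: x])) => /and3P[].
      by rewrite (valid_cons (cars_bounds g (y :: rcons t x))) last_map last_rcons => /and3P[].
    move=> gx; apply/andP; split; last first.
      by have := ms x; rewrite -index_mem sz /col; lia.
    have := ms i; rewrite e mem_rcons inE => /predU1P[->//|ix].
    by move: ps; rewrite e pairwise_rcons => /andP[/allP/(_ _ ix) + _]; rewrite /le; lia.
  have := ms i; case: s {us sn sz sv ps le le_trans ms} @col head_le last_ge => // x s col hl ll _.
  have := hl x s erefl; have := ll (last x s) (belast x s) (lastI x s); lia.
(* The default value [i] is never taken, by [col_bounds]. *)
pose f := [ffun i => insubd i `|col i|%N].
have fE i : (f i)%:Z%R = col i.
  by rewrite ffunE val_insubd; have := col_bounds i; case: ifP; lia.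
have sE : row_order f = s.
  apply: row_order_eq => //; apply: sub_pairwise ps => i j.
  by rewrite /le /below -!fE -val_eqE ltz_nat eqz_nat.
by exists f => // i; rewrite /pdiag /pcol fE prow_index sE /col; lia.
Qed.

(** For fixed diagonals [row_order] is a bijection onto the valid orders: it is injective because
    the column is the position minus the diagonal. *)
Lemma sum_pref_diag (R : comNzRingType) (q : R) (g : 'I_n -> int) : 0 < n ->
  (\sum_(f : {ffun 'I_n -> 'I_n} | [forall i, pdiag f i == g i]) q ^+ attacks (cars f) =
   wsum q (valid n.+1) (map (car_of g) (enum 'I_n)))%R.
Proof.
move=> n0; have carI : injective (car_of g) by move=> i j [/val_inj].
rewrite /wsum (perm_big _ (perm_permutations_map carI (enum_uniq _))) big_map.
rewrite -[RHS]big_filter; pose P f := [forall i, pdiag f i == g i].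
have pr : perm_eq (map row_order [seq f <- enum {: {ffun 'I_n -> 'I_n}} | P f])
    [seq s <- permutations (enum 'I_n) | valid n.+1 (map (car_of g) s)].
  apply: uniq_perm; rewrite ?filter_uniq ?permutations_uniq //.
    rewrite map_inj_in_uniq ?filter_uniq -?enumT ?enum_uniq // => f1 f2.
    rewrite !mem_filter => /andP[/forallP P1 _] /andP[/forallP P2 _] e.
    apply/ffunP => i; apply: val_inj; move: (P1 i) (P2 i).
    by rewrite /pdiag !prow_index e /pcol /=; lia.
  move=> s; rewrite mem_filter mem_permutations; apply/mapP/andP.
    move=> [f + ->]; rewrite mem_filter => /andP[/forallP Pf _].
    split; last exact: row_order_perm.
    have := valid_cars f n0; rewrite /cars (_ : map _ _ = map (car_of g) (row_order f)) //.
    by apply: eq_map => i; rewrite /car_of (eqP (Pf i)).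
  move=> [sv sn]; have [f fs fg] := row_order_surj sn sv.
  exists f => //; rewrite mem_filter mem_enum andbT.
  by apply/forallP => i; rewrite fg.
rewrite -(perm_big _ pr) big_map big_filter big_enum_cond /=.
apply: eq_big => // f /forallP Pf.
congr (_ ^+ attacks _)%R; rewrite /cars.
by apply: eq_map => i; rewrite /car_of (eqP (Pf i)).
Qed.

(** * Preference functions with given diagonal word and deviation *)

Section Tau.
Variables (tau : seq nat) (l : nat).
Hypotheses (n_gt0 : 0 < n) (tau_perm : perm_eq tau (iota 1 n)).

Let tau_uniq : uniq tau.
Proof. by rewrite (perm_uniq tau_perm) iota_uniq. Qed.

Let tau_ord : perm_eq tau [seq (val i).+1 | i <- enum 'I_n].
Proof.
rewrite (map_comp S val) val_enum_ord (perm_trans tau_perm) //.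
by rewrite -[1]/(1 + 0) iotaDl.
Qed.

Let mem_tau i : i.+1 \in tau.
Proof. by rewrite (perm_mem tau_perm) mem_iota /= add1n ltnS. Qed.

(** Run [l] from the end is placed on diagonal 0 and the last run on the lowest diagonal, [-l]. *)
Definition tau_diag (c : nat) : int := ((rie tau c)%:Z - l%:Z)%R.

Let tau_cars := [seq (c, tau_diag c) | c <- tau].

Let perm_tau_cars : perm_eq tau_cars (map (car_of (fun i => tau_diag i.+1)) (enum 'I_n)).
Proof.
apply: (@perm_trans _ [seq (c, tau_diag c) | c <- [seq (val i).+1 | i <- enum 'I_n]]).
  exact: perm_map.
by rewrite -map_comp.
Qed.

Lemma tau_neq0 : exists x s, tau = x :: s.
Proof.
case: tau tau_perm => [/perm_size|x s _]; last by exists x, s.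
by rewrite size_iota /= => n0; move: n_gt0; rewrite -n0.
Qed.

(** Given the word, [sorted_attack] and [rie_of_path_attack] make the diagonals run numbers up to a
    shift, which the deviation fixes. Conversely, the diagonals determine the word by uniqueness of
    sorting. *)
Lemma pref_tau_diag f :
  (diagword f == tau) && (pdev f == l) = [forall i, pdiag f i == tau_diag i.+1].
Proof.
have [x [s tauE]] := tau_neq0.
have us : uniq (x :: s) by rewrite -tauE.
have last0 : exists i : 'I_n, i.+1 = last x s.
  have : last x s \in map (fun i : 'I_n => i.+1) (enum 'I_n).
    by rewrite -(perm_mem tau_ord) tauE mem_last.
  by case/mapP => i _ ->; exists i.
have [i0 i0E] := last0.
have rie0 : rie tau i0.+1 = 0 by rewrite i0E tauE rie_last.
apply/andP/forallP => [[/eqP dw /eqP dev] i|H]; last first.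
  have {}H i : pdiag f i = tau_diag i.+1 by exact/eqP.
  split; last by apply/eqP; apply: pdev_eq H _; exists i0.
  rewrite diagword_cars (_ : diag_cars f = tau_cars) ?/tau_cars -?map_comp ?map_id //.
  apply: (pairwise_eq (r := lexdiag)).
  - by move=> a b /andP[/lexdiag_trans ab /ab]; rewrite lexdiag_irr.
  - exact: diag_cars_pairwise.
  - exact: pairwise_lexdiag_rie.
  - apply: perm_trans (diag_cars_perm f) _; rewrite perm_sym; apply: perm_trans perm_tau_cars _.
    by rewrite (eq_map (g := car_of (pdiag f))) // => j; rewrite /car_of H.
(* The diagonal as a function of the label; the value 0 is only taken off the labels of cars. *)
pose g c := if insub c.-1 is Some j then pdiag f j else 0%R.
have gE j : g j.+1 = pdiag f j by rewrite /g /= valK.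
have dE : diag_cars f = [seq (c, g c) | c <- tau].
  rewrite -dw diagword_cars -map_comp -[LHS]map_id; apply/eq_in_map => a.
  by rewrite (perm_mem (diag_cars_perm f)) => /mapP[j _ ->]; rewrite /= gE.
have cp : perm_eq (diag_cars f) (cars f).
  by rewrite (perm_trans (diag_cars_perm f)) // perm_map // perm_sym row_order_perm.
have := sorted_attack (diag_cars_pairwise f) cp (cars_bounds _ _) (valid_cars f n_gt0).
rewrite dE tauE => /(rie_of_path_attack us) grie.
(* The first car by rows has diagonal at most 0, and the last letter of the word lies on the lowest
   diagonal. *)
have last_le0 : (g (last x s) <= 0)%R.
  have := valid_cars f n_gt0; have := cars_bounds (pdiag f) (row_order f).
  rewrite -/(cars f) /cars; case e: (row_order f) => [|j t].
    by have := mem_row_order f i; rewrite e.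
  move=> cb; rewrite valid_cons // => /andP[/= j0 _].
  have := grie j.+1; rewrite -tauE mem_tau gE => /(_ isT); move: j0; lia.
have pE j : pdiag f j = ((rie tau j.+1)%:Z - (`|g (last x s)|%N)%:Z)%R.
  by have := grie j.+1; rewrite -tauE mem_tau gE => /(_ isT); lia.
have devE : pdev f = `|g (last x s)|%N by apply: pdev_eq pE _; exists i0.
by rewrite pE /tau_diag -dev devE.
Qed.

Lemma run_nonempty : l < nruns tau -> run tau l != [::].
Proof.
move=> lr; rewrite -nth_rev_runs //.
have runs_n0 s : [::] \notin runs s.
  elim: s => // x [//|y s]; have [r [rs [-> ->]]] := runs_cons2 x y s.
  by case: ifP => _; rewrite !inE.
apply: contraNneq (runs_n0 tau) => <-.
by rewrite -mem_rev mem_nth // size_rev.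
Qed.

Lemma wsum_tau (R : comNzRingType) (q : R) : l < nruns tau ->
  (wsum q (valid n.+1) (map (car_of (fun i => tau_diag i.+1)) (enum 'I_n)) =
   \prod_(c <- tau) qint q (lsched tau l c))%R.
Proof.
move=> lr; rewrite -(wsum_perm _ _ perm_tau_cars) wsum_prod; first last.
- have := run_nonempty lr; rewrite -has_filter => /hasP[c ct /eqP cl].
  by apply/hasP; exists (c, tau_diag c); rewrite ?map_f // /tau_diag /= cl subrr.
- rewrite (perm_all _ perm_tau_cars); exact: cars_bounds.
- exact: pairwise_lexdiag_rie.
rewrite big_map; apply: eq_big_seq => c ct.
by rewrite (car_weight_lsched tau_uniq lr ct).
Qed.

Lemma card_negative f : [forall i, pdiag f i == tau_diag i.+1] ->
  #|[set i | (pdiag f i < 0)%R]| = \sum_(j < l) rho tau j.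
Proof.
move=> /forallP H.
have neg i : (pdiag f i < 0)%R = (rie tau i.+1 < l).
  by rewrite (eqP (H i)) /tau_diag subr_lt0 ltz_nat.
rewrite (eq_card (B := [pred i : 'I_n | rie tau i.+1 < l])); last by move=> i; rewrite !inE neg.
rewrite cardE /enum_mem size_filter -enumT.
rewrite -[LHS]/(count (preim (fun i : 'I_n => (val i).+1) (fun c => rie tau c < l)) (enum 'I_n)).
rewrite -count_map -(permP tau_ord) -size_filter -count_predT.
rewrite (count_sum_filter _ (h := rie tau) (m := l)) ?filter_all //.
apply: eq_bigr => j _; rewrite rho_run // count_predT -filter_predI; congr size.
by apply: eq_filter => x /=; case: eqP => // ->; rewrite ltn_ord.
Qed.

Lemma sum_diag f : [forall i, pdiag f i == tau_diag i.+1] -> pdev f = l ->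
  parea f = ((\sum_(c <- tau) rie tau c)%N)%:Z%R.
Proof.
move=> /forallP H dev; rewrite /parea dev (perm_big _ tau_ord) big_map big_enum /=.
rewrite (big_morph Posz PoszD (erefl _)).
by apply: eq_bigr => i _; rewrite (eqP (H i)) /tau_diag subrK.
Qed.

End Tau.
End PrefCars.

(** * The major index as a sum of run numbers *)

Lemma sum_descents_cons (G : nat -> nat) (x y : nat) (s : seq nat) (t := x :: y :: s) :
  \sum_(1 <= i < size t | nth 0 t i < nth 0 t i.-1) G i =
  (y < x) * G 1 +
  \sum_(1 <= i < size (y :: s) | nth 0 (y :: s) i < nth 0 (y :: s) i.-1) G i.+1.
Proof.
rewrite big_mkcond big_ltn // big_add1 [in RHS]big_mkcond /=; congr (_ + _).
  by case: (y < x); rewrite ?mul1n.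
by apply: eq_big_nat => -[|i].
Qed.

Lemma nruns_descents (s : seq nat) : uniq s ->
  \sum_(1 <= i < size s | nth 0 s i < nth 0 s i.-1) 1 = (nruns s).-1.
Proof.
elim: s => [_|x [|y s] IH /andP[xs us]]; [by rewrite big_geq | by rewrite big_geq|].
have xy : x != y by apply: contraNneq xs => ->; rewrite mem_head.
have := mem_runs_index (mem_head y s).
rewrite (sum_descents_cons (fun=> 1)) (IH us) nruns_cons2.
by move: xy; case: nruns => // m; lia.
Qed.

(** Prepending [x] moves every old descent by one place and may create one at position 1; the gain
    is the number of descents of the new word, which is the run number of [x]. *)
Lemma maj_rie (s : seq nat) : uniq s -> maj s = \sum_(c <- s) rie s c.
Proof.
elim: s => [_|x s IH us]; first by rewrite /maj big_geq ?big_nil.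
have [xs us'] := andP us; have {}IH := IH us'.
have -> : \sum_(c <- x :: s) rie (x :: s) c = (nruns (x :: s)).-1 + maj s.
  rewrite big_cons rie_head IH; congr (_ + _); apply: eq_big_seq => c cs.
  by rewrite rie_behead //; apply: contraNneq xs => <-.
rewrite -nruns_descents // /maj; case: s {IH xs us us'} => [|y s].
  by rewrite !big_geq.
rewrite !sum_descents_cons -addnA -big_split; congr (_ + _).
Qed.

(** * The multiset identity and the generating function *)

Theorem theorem3p1 (n : nat) (tau : seq nat) (l : nat) :
  (1 <= n)%N ->
  perm_eq tau (iota 1 n) ->
  (1 <= l <= (nruns tau).-1)%N ->
  perm_eq [seq lsched tau l c | c <- iota 1 n]
          (rem (rho tau 0) (rho tau l :: schedule tau))
  /\
  (forall (F : fieldType) (t q : F),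
     qint q (rho tau 0) != 0%R ->
     (\sum_(f : {ffun 'I_n -> 'I_n} | (diagword f == tau) && (pdev f == l))
         t ^ parea f * q ^+ pdinv f)%R
     = (t ^+ maj tau * q ^+ (\sum_(j < l) rho tau j)
        * (qint q (rho tau l) / qint q (rho tau 0))
        * \prod_(w <- schedule tau) qint q w)%R).
Proof.
move=> n_gt0 tau_perm /andP[l_gt0 l_le].
have tau_uniq : uniq tau by rewrite (perm_uniq tau_perm) iota_uniq.
have l_lt : l < nruns tau by lia.
have sched_perm := perm_lsched tau_uniq l_lt.
have rho_mem : rho tau 0 \in rho tau l :: schedule tau.
  by rewrite -(perm_mem sched_perm) mem_head.
split.
  rewrite -(perm_cons (rho tau 0)) -(permPr (perm_to_rem rho_mem)).
  apply: perm_trans sched_perm; rewrite perm_cons; apply: perm_map.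
  by rewrite perm_sym.
move=> F t q rho0; set c := (t ^+ maj tau * q ^+ (\sum_(j < l) rho tau j))%R.
(* Area and the number of cars in negative diagonals depend only on the diagonals, so they leave the
   sum as the constant [c]. *)
have -> : (\sum_(f : {ffun 'I_n -> 'I_n} | (diagword f == tau) && (pdev f == l))
         t ^ parea f * q ^+ pdinv f)%R =
   (c * \sum_(f : {ffun 'I_n -> 'I_n} | [forall i, pdiag f i == tau_diag tau l i.+1])
      q ^+ attacks (cars f))%R.
  rewrite mulr_sumr; apply: eq_big => f; first exact: pref_tau_diag.
  move=> fP; have fd : [forall i, pdiag f i == tau_diag tau l i.+1].
    by rewrite -pref_tau_diag.
  have /andP[_ /eqP dev] := fP.
  rewrite (sum_diag tau_perm fd dev) -maj_rie // pdinv_attacks (card_negative tau_perm fd).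
  by rewrite -exprnP exprD mulrA mulrAC.
rewrite sum_pref_diag // wsum_tau // -mulrA; congr (_ * _)%R.
(* Equal multisets give equal products; the nonzero factor of [rho tau 0] is then divided off. *)
have : (\prod_(w <- rho tau 0%N :: [seq lsched tau l c | c <- tau]) qint q w =
   \prod_(w <- rho tau l :: schedule tau) qint q w)%R by exact: perm_big.
rewrite !big_cons big_map => e.
by rewrite mulrAC -e mulrC mulKf.
Qed.
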